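(* Let $p\in\mathbb{R}[x_1,\dots,x_n]$ and let $Q\subseteq\mathbb{Z}_+^n$ satisfy $\mathrm{SOSS}(p,Q)$. If $p$ is SOS, then $\alpha\in Q+Q$ for every $\alpha\in S(p)$.
   Context: Polynomials have real coefficients. A polynomial $p\in\mathbb{R}[x_1,\dots,x_n]$ is SOS if $p=\sum_{i=1}^s q_i^2$ for some finitely many $q_1,\dots,q_s\in\mathbb{R}[x_1,\dots,x_n]$. $\mathbb{Z}_+$ is the set of non-negative integers. The support $S(p)\subseteq\mathbb{Z}_+^n$ of $p=\sum_\alpha c_\alpha x^\alpha$ is the set of exponent vectors with nonzero coefficient. A set $Q\subseteq\mathbb{Z}_+^n$ satisfies the relation $\mathrm{SOSS}(p,Q)$ if: whenever $p$ is SOS, there exist $q_1,\dots,q_s$ with $p=\sum_{i=1}^s q_i^2$ and $S(q_i)\subseteq Q$ for all $i$. $Q+Q$ is the Minkowski sum. *)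

(* Defs.v *)
From mathcomp Require Import all_boot all_algebra.
From mathcomp Require Import classical_sets reals.
From mathcomp.multinomials Require Import mpoly.

Set Implicit Arguments.
Unset Strict Implicit.
Unset Printing Implicit Defensive.

Import GRing.Theory.
Local Open Scope ring_scope.
Local Open Scope classical_set_scope.

Section SumsOfSquares.
Context (R : realType) (n : nat).
Implicit Types (p : {mpoly R[n]}) (Q : set 'X_{1..n}).

(* Exponent vectors in Z_+^n are the multinomials 'X_{1..n}. *)
Definition supp p : set 'X_{1..n} := [set a | a \in msupp p].

Definition isSOS p : Prop :=
  exists (s : nat) (q : 'I_s -> {mpoly R[n]}), p = \sum_(i < s) q i ^+ 2.

Definition SOSS p Q : Prop :=
  isSOS p ->
  exists (s : nat) (q : 'I_s -> {mpoly R[n]}),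
    p = \sum_(i < s) q i ^+ 2 /\ forall i, supp (q i) `<=` Q.

Definition minkowski Q1 Q2 : set 'X_{1..n} :=
  [set (a + b)%MM | a in Q1 & b in Q2].

End SumsOfSquares.

(* Main.v *)
Require Import Defs.
From mathcomp Require Import all_boot all_algebra.
From mathcomp Require Import classical_sets reals.
From mathcomp.multinomials Require Import mpoly.

(** Supports are subadditive under sums, and the support of a product lies in
    the Minkowski sum of the supports.  Hence, for a decomposition of [p] into
    squares of polynomials supported in [Q], each exponent of [p] occurs in one
    of the squares, and so is a sum of two exponents from [Q].  Cancellation
    between squares can only shrink the support of [p]. *)

Theorem lemma8 (R : realType) (n : nat) (p : {mpoly R[n]})
    (Q : set 'X_{1..n}) (hQ : SOSS p Q) (hp : isSOS p) :
  forall a : 'X_{1..n}, supp p a -> minkowski Q Q a.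
Proof.
have [s [q [-> qQ]]] := hQ hp => a /msupp_sum_le /flatten_mapP[i _].
rewrite GRing.expr2 => /msuppM_le /allpairsP[[b c] /= [bq cq ->]].
by exists b; [exact: qQ bq | exists c; [exact: qQ cq | ]].
Qed.
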